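(* $R_{\mathrm{vm}}(4)=11$.
   Context: All graphs are finite and simple. For a vertex $v$ of $G$, the local complementation $G*v$ is obtained from $G$ by complementing the induced subgraph on the neighborhood $N_G(v)$, all other edges unchanged. The LC orbit $[G]_{\mathrm{LC}}$ is the set of graphs obtained from $G$ by finite sequences of local complementations. A graph $H$ is a vertex-minor of $G$ if $H$ is isomorphic to an induced subgraph of some graph in $[G]_{\mathrm{LC}}$. $E_k$ denotes the edgeless graph on $k$ vertices. The vertex-minor Ramsey number $R_{\mathrm{vm}}(k)$ is the smallest integer $n$ such that every graph on $n$ vertices contains $E_k$ as a vertex-minor. *)

(* Defs.v *)
From mathcomp Require Import all_boot.

Set Implicit Arguments.
Unset Strict Implicit.
Unset Printing Implicit Defensive.

Record sgraph (T : finType) := SGraph {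
  adj :> rel T;
  adj_sym : symmetric adj;
  adj_irrefl : irreflexive adj
}.

Section LocalComplementation.
Variables (T : finType) (G : sgraph T) (v : T).

Definition local_compl_adj : rel T :=
  fun x y => if [&& adj G v x, adj G v y & x != y]
             then ~~ adj G x y else adj G x y.

Lemma local_compl_sym : symmetric local_compl_adj.
Proof.
move=> x y; rewrite /local_compl_adj (adj_sym G x y) (eq_sym x y).
by case: (adj G v x); case: (adj G v y).
Qed.

Lemma local_compl_irrefl : irreflexive local_compl_adj.
Proof. by move=> x; rewrite /local_compl_adj eqxx !andbF adj_irrefl. Qed.

Definition local_compl : sgraph T := SGraph local_compl_sym local_compl_irrefl.

End LocalComplementation.

(* Graphs are compared by extensional equality of their adjacency relations,
   since Leibniz equality on [sgraph] also compares functions and proofs. *)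
Definition lc_orbit (T : finType) (G G' : sgraph T) : Prop :=
  exists s : seq T, adj G' =2 adj (foldl (@local_compl T) G s).

Section InducedSubgraph.
Variables (T : finType) (G : sgraph T) (S : {set T}).

Definition induced_adj : rel {x : T | x \in S} :=
  fun x y => adj G (val x) (val y).

Lemma induced_sym : symmetric induced_adj.
Proof. by move=> x y; apply: adj_sym. Qed.

Lemma induced_irrefl : irreflexive induced_adj.
Proof. by move=> x; apply: adj_irrefl. Qed.

Definition induced : sgraph {x : T | x \in S} :=
  SGraph induced_sym induced_irrefl.

End InducedSubgraph.

Definition isomorphic (T U : finType) (G : sgraph T) (H : sgraph U) : Prop :=
  exists2 f : T -> U, bijective f & forall x y, adj H (f x) (f y) = adj G x y.

Definition vertex_minor (U T : finType) (H : sgraph U) (G : sgraph T) : Prop :=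
  exists2 G' : sgraph T, lc_orbit G G' &
    exists S : {set T}, isomorphic H (induced G' S).

Section Edgeless.
Variable k : nat.

Definition edgeless_adj : rel 'I_k := fun _ _ => false.

Lemma edgeless_sym : symmetric edgeless_adj.
Proof. by []. Qed.

Lemma edgeless_irrefl : irreflexive edgeless_adj.
Proof. by []. Qed.

Definition edgeless : sgraph 'I_k := SGraph edgeless_sym edgeless_irrefl.

End Edgeless.

Definition vm_unavoidable (k n : nat) : Prop :=
  forall (T : finType) (G : sgraph T), #|T| = n -> vertex_minor (edgeless k) G.

(* [vm_ramsey k n] reads "R_vm(k) = n": being a least element, such an n is
   unique, and the predicate also asserts that it exists. *)
Definition vm_ramsey (k n : nat) : Prop :=
  vm_unavoidable k n /\ forall m : nat, vm_unavoidable k m -> n <= m.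

(* Main.v *)
(* Call a graph E_4-free if E_4 is not a vertex-minor of it.  The E_4-free graphs
   on n vertices, up to local equivalence and isomorphism, are found one vertex
   at a time: there are 1, 2, 3, 5, 6, 9, 8, 10, 2, 1, 0 classes for
   n = 1, ..., 11.

   Let M represent a class on n vertices, and add a vertex v with neighbourhood
   N.  If local complementations at old vertices turn M into a graph with an
   independent triple and N into a set avoiding that triple, then the triple and
   v form E_4.  A local complementation at u acts linearly on N (N becomes
   N + N_u M_u), so one word settles many N at once.  Each of the few remaining
   N comes with an explicit local equivalence and isomorphism to a
   representative on n + 1 vertices.

   The only E_4-free graph on 10 vertices has an LC orbit with 6 isomorphism
   types, none of which has 4 independent vertices. *)

Require Import Defs.
From mathcomp Require Import all_boot.

Set Implicit Arguments.
Unset Strict Implicit.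
Unset Printing Implicit Defensive.

(** * Boolean adjacency matrices and the checks run on certificates *)

Definition matrix := seq (seq bool).

Definition entry (M : matrix) i j := nth false (nth [::] M i) j.

Definition lc_mx (M : matrix) (u : nat) : matrix :=
  let ru := nth [::] M u in
  mkseq (fun i => let ri := nth [::] M i in
    if nth false ru i
    then mkseq (fun j => nth false ri j (+) (nth false ru j && ~~ eqn i j))
               (size M)
    else ri) (size M).

Definition sub_mx (M : matrix) (p : seq nat) : matrix :=
  [seq [seq entry M i j | j <- p] | i <- p].

(** The new vertex takes index 0 and the old indices go up by one; the words and permutations
    applied to an extended matrix use this numbering. *)
Definition extend_mx (M : matrix) (N : seq bool) : matrix :=
  (false :: N) :: [seq x.1 :: x.2 | x <- zip N M].

Definition lc_row (N : seq bool) (ur : nat * seq bool) : seq bool :=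
  if nth false N ur.1 then [seq x.1 (+) x.2 | x <- zip N ur.2] else N.

(* The rows to be used by the successive [lc_row] are those of the graph as
   transformed so far. *)
Fixpoint pivot_rows (M : matrix) (w : seq nat) : seq (nat * seq bool) :=
  if w is u :: w' then (u, nth [::] M u) :: pivot_rows (lc_mx M u) w' else [::].

Definition in_range n (s : seq nat) := all (fun i => i < n) s.

Definition indep_mx (M : matrix) (S : seq nat) :=
  all (fun i => all (fun j => ~~ entry M i j) S) S.

Definition triples n : seq (seq nat) :=
  flatten [seq flatten [seq [seq [:: i; j; k] | i <- iota 0 j] | j <- iota 0 k]
          | k <- iota 0 n].

(** Range and distinctness are tested by computation, so the proof has to know only the length of
    the members of [triples]. *)
Definition indep_triples (M : matrix) :=
  [seq S <- triples (size M) | [&& in_range (size M) S, uniq S & indep_mx M S]].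

Definition avoids (N : seq bool) (S : seq nat) := all (fun i => ~~ nth false N i) S.

Definition unsettled (M : matrix) (w : seq nat) (Ns : seq (seq bool)) :=
  let urs := pivot_rows M w in
  let Ss := indep_triples (foldl lc_mx M w) in
  [seq N <- Ns | ~~ has (avoids (foldl lc_row N urs)) Ss].

Fixpoint all_rows n : seq (seq bool) :=
  if n is m.+1 then
    let s := all_rows m in [seq false :: N | N <- s] ++ [seq true :: N | N <- s]
  else [:: [::]].

(** [p] lists vertices of the transformed graph in the order in which [M'] numbers them. *)
Definition lc_iso_mx (M M' : matrix) (w p : seq nat) :=
  [&& in_range (size M) w, in_range (size M) p, uniq p
    & sub_mx (foldl lc_mx M w) p == M'].

(** First the words that settle neighbourhoods; then, for each neighbourhood left over, in order:
    the index of a representative, a word on the extended graph, and an isomorphism. *)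
Definition certificate : Type := (seq (seq nat) * seq (nat * seq nat * seq nat))%type.

Definition extensions_ok (Ms : seq matrix) (M : matrix) (c : certificate) :=
  all (in_range (size M)) c.1 &&
  all2 (fun N (rwp : nat * seq nat * seq nat) =>
          let: (r, w, p) := rwp in
          (r < size Ms) && lc_iso_mx (extend_mx M N) (nth [::] Ms r) w p)
       (foldl (fun Ns w => unsettled M w Ns) (all_rows (size M)) c.1) c.2.

Definition orbit_closed (Ms : seq matrix) (cs : seq (seq (nat * seq nat))) :=
  all2 (fun M rps =>
    all2 (fun u (rp : nat * seq nat) =>
           (rp.1 < size Ms) && lc_iso_mx M (nth [::] Ms rp.1) [:: u] rp.2)
         (iota 0 (size M)) rps) Ms cs.

Definition no_indep4 (M : matrix) :=
  let n := iota 0 (size M) in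
  all (fun i => all (fun j => eqn i j || entry M i j ||
    all (fun k => eqn i k || eqn j k || entry M i k || entry M j k ||
      all (fun l => eqn i l || eqn j l || eqn k l || entry M i l || entry M j l
                    || entry M k l) n) n) n) n.

(** * Search for local equivalences and isomorphisms *)

(* The search below is not verified: it is run once to produce certificates,
   which [extensions_ok] and [orbit_closed] then check. *)
Definition first_some (A B : Type) (f : A -> option B) :=
  fix first s := if s is x :: s' then
                   if f x is Some y then Some y else first s'
                 else None.

Definition degree (r : seq bool) := count id r.
Definition degrees (M : matrix) := sort leq (map degree M).

(** Backtracking: the vertices of [K] receive their images in [M] in order, pruned by degree and by
    adjacency to the earlier ones. *)
Fixpoint find_iso (M K : matrix) k (p : seq nat) : option (seq nat) :=
  if k is k'.+1 then
    let i := size p in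
    first_some (fun c =>
      if [&& c \notin p, degree (nth [::] M c) == degree (nth [::] K i)
           & all (fun j => entry M c (nth 0 p j) == entry K i j) (iota 0 i)]
      then find_iso M K k' (rcons p c) else None) (iota 0 (size M))
  else Some p.

Definition find_in_orbit (orb : seq (seq nat * matrix * seq nat)) (M : matrix) :=
  let d := degrees M in
  first_some (fun x : seq nat * matrix * seq nat =>
    let: (d', K, w) := x in
    if d == d' then
      if find_iso M K (size M) [::] is Some p then Some (w, p) else None
    else None) orb.

Fixpoint search_orbit fuel (todo seen : seq (seq nat * matrix * seq nat)) :=
  if fuel is fuel'.+1 then
    if todo is (_, M, w) :: todo' then
      let new := foldl (fun new u =>
        let M' := lc_mx M u in
        if find_in_orbit (new ++ seen) M' is Some _ then new
        else rcons new (degrees M', M', rcons w u)) [::] (iota 0 (size M)) in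
      search_orbit fuel' (todo' ++ new) (seen ++ new)
    else seen
  else seen.

Definition lc_class (M : matrix) :=
  let x := [:: (degrees M, M, [::])] in search_orbit 1000 x x.

Fixpoint words n d : seq (seq nat) :=
  if d is d'.+1 then
    [::] :: [seq u :: w | u <- iota 0 n, w <- words n d']
  else [:: [::]].

Definition useful_words (M : matrix) d :=
  foldl (fun (x : seq (seq nat) * seq (seq bool)) w =>
           let Ns := unsettled M w x.2 in
           if size Ns == size x.2 then x else (rcons x.1 w, Ns))
        ([::], all_rows (size M)) (words (size M) d).

(** The search finds a word [w] from the representative to a matrix that [p] identifies with the
    extension. Local complementations are involutions, so the reversed word, renamed by [p], leads
    from the extension back to the representative. A failed search yields a default that the check
    rejects. *)
Definition certify (orbs : seq (seq (seq nat * matrix * seq nat)))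
    (dM : nat * matrix) : certificate :=
  let: (d, M) := dM in
  let: (ws, Ns) := useful_words M d in
  (ws, [seq odflt (0, [::], [::])
        (first_some (fun r =>
           if find_in_orbit (nth [::] orbs r) (extend_mx M N) is Some (w, p)
           then Some (r, map (nth 0 p) (rev w), p) else None)
           (iota 0 (size orbs))) | N <- Ns]).

(** * Tables of classes and their certificates *)

(* [rows n s] decodes a graph on n vertices: the i-th number of [s] is the set of
   neighbours of i in binary. *)
Definition rows n (s : seq nat) : matrix :=
  [seq mkseq (fun i => odd (iter i half x)) n | x <- s].

(* Each pair is [(d, M)], where M is chosen in its LC orbit so that words of
   length at most d settle every neighbourhood that can be settled. *)
Definition representatives : seq (seq (nat * matrix)) :=
  [seq [seq (x.1, rows (size x.2) x.2) | x <- s] | s <- [::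
  [:: (0, [::])];
  [:: (0, [:: 0])];
  [:: (0, [:: 0; 0]);
      (0, [:: 2; 1])];
  [:: (0, [:: 0; 0; 0]);
      (0, [:: 0; 4; 2]);
      (0, [:: 4; 4; 3])];
  [:: (1, [:: 0; 0; 8; 4]);
      (0, [:: 0; 8; 8; 6]);
      (0, [:: 8; 8; 8; 7]);
      (0, [:: 8; 4; 2; 1]);
      (0, [:: 8; 4; 10; 5])];
  [:: (2, [:: 0; 16; 8; 4; 2]);
      (1, [:: 16; 16; 8; 4; 3]);
      (1, [:: 0; 16; 8; 20; 10]);
      (1, [:: 16; 16; 8; 20; 11]);
      (0, [:: 16; 8; 24; 6; 5]);
      (0, [:: 24; 20; 10; 5; 3])];
  [:: (3, [:: 32; 16; 8; 4; 2; 1]);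
      (2, [:: 32; 16; 8; 4; 34; 17]);
      (2, [:: 32; 16; 8; 36; 34; 25]);
      (1, [:: 32; 16; 40; 20; 10; 5]);
      (1, [:: 0; 48; 40; 20; 10; 6]);
      (1, [:: 32; 48; 40; 20; 10; 7]);
      (1, [:: 32; 16; 8; 52; 42; 25]);
      (0, [:: 40; 36; 18; 17; 44; 19]);
      (0, [:: 56; 52; 42; 21; 11; 7])];
  [:: (2, [:: 2; 1; 96; 80; 40; 20; 12]);
      (2, [:: 8; 96; 80; 65; 100; 82; 62]);
      (3, [:: 68; 112; 41; 116; 106; 94; 59]);
      (1, [:: 96; 80; 40; 20; 10; 5; 3]);
      (2, [:: 16; 72; 112; 98; 37; 92; 46]);
      (1, [:: 0; 112; 104; 84; 42; 22; 14]);
      (1, [:: 64; 112; 104; 84; 74; 70; 63]);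
      (3, [:: 24; 100; 82; 97; 37; 90; 46])];
  [:: (2, [:: 2; 1; 224; 208; 168; 84; 44; 28]);
      (2, [:: 2; 129; 224; 208; 168; 148; 140; 126]);
      (3, [:: 130; 65; 224; 208; 232; 212; 62; 61]);
      (3, [:: 48; 136; 224; 194; 225; 85; 188; 94]);
      (3, [:: 112; 196; 162; 240; 233; 157; 155; 126]);
      (3, [:: 32; 208; 200; 148; 74; 193; 54; 46]);
      (3, [:: 224; 208; 56; 244; 174; 93; 171; 91]);
      (3, [:: 224; 112; 216; 180; 142; 139; 135; 125]);
      (3, [:: 160; 80; 232; 212; 202; 197; 62; 61]);
      (3, [:: 208; 168; 248; 230; 229; 94; 61; 31])];
  [:: (2, [:: 136; 292; 274; 193; 452; 450; 312; 313; 246]);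
      (2, [:: 304; 388; 194; 480; 449; 329; 60; 30; 59])];
  [:: (2, [:: 642; 577; 296; 276; 744; 724; 818; 817; 716; 499])];
  [::]]].

(** Levels are indexed by the number of vertices: level 0 holds the empty matrix, where the
    induction starts, and level 11 is empty. *)
Definition classes : seq (seq matrix) :=
  Eval vm_compute in [seq map snd s | s <- representatives].

Definition certificates : seq (seq certificate) := Eval vm_compute in
  [seq let orbs := [seq lc_class M | M <- nth [::] classes n.+1] in
       [seq certify orbs x | x <- nth [::] representatives n] | n <- iota 0 11].

(** At [n = 10] the next level is empty, so the check succeeds only if the words settle all 1024
    neighbourhoods. *)
Lemma classes_ok : all (fun n =>
  all2 (extensions_ok (nth [::] classes n.+1)) (nth [::] classes n)
       (nth [::] certificates n)) (iota 0 11).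
Proof. by vm_compute. Qed.

Definition orbit10 : seq matrix := Eval vm_compute in
  [seq x.1.2 | x <- lc_class (head [::] (nth [::] classes 10))].

Definition orbit10_certificates : seq (seq (nat * seq nat)) :=
  Eval vm_compute in
  [seq [seq odflt (0, [::]) (first_some (fun r =>
         if find_iso (lc_mx M u) (nth [::] orbit10 r) (size M) [::] is Some p
         then Some (r, p) else None) (iota 0 (size orbit10)))
       | u <- iota 0 (size M)] | M <- orbit10].

Lemma orbit10_closed : orbit_closed orbit10 orbit10_certificates.
Proof. by vm_compute. Qed.

Lemma orbit10_no_indep4 : all no_indep4 orbit10.
Proof. by vm_compute. Qed.

(** * Graphs and the matrices of their induced subgraphs *)

Lemma local_complE (T : finType) (G : sgraph T) v x y :
  adj (local_compl G v) x y =
  adj G x y (+) [&& adj G v x, adj G v y & x != y].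
Proof.
by rewrite /= /local_compl_adj; case: ifP => _; rewrite ?addbT ?addbF.
Qed.

Definition lc_word (T : finType) (G : sgraph T) (s : seq T) : sgraph T :=
  foldl (@local_compl T) G s.

Definition adj_row (T : finType) (G : sgraph T) (t : seq T) (v : T) : seq bool :=
  [seq adj G v y | y <- t].

Definition adj_mx (T : finType) (G : sgraph T) (t : seq T) : matrix :=
  [seq adj_row G t x | x <- t].

(** Working form of having E_k as a vertex-minor: a word replaces the orbit, and a list of distinct
    vertices replaces the isomorphism. *)
Definition lc_indep (T : finType) k (G : sgraph T) :=
  exists s t : seq T, [/\ uniq t, size t = k
    & {in t &, forall x y, adj (lc_word G s) x y = false}].

Section Realization.
Variables (T : finType) (x0 : T).
Implicit Types (G : sgraph T) (s t : seq T) (w p : seq nat) (M : matrix).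

Lemma lc_word_cat G s1 s2 : lc_word G (s1 ++ s2) = lc_word (lc_word G s1) s2.
Proof. exact: foldl_cat. Qed.

Lemma lc_indep_word k G s : lc_indep k (lc_word G s) -> lc_indep k G.
Proof. by case=> s' [t]; rewrite -lc_word_cat; exists (s ++ s'), t. Qed.

Lemma size_adj_mx G t : size (adj_mx G t) = size t.
Proof. exact: size_map. Qed.

Lemma nth_adj_row G t v j : j < size t ->
  nth false (adj_row G t v) j = adj G v (nth x0 t j).
Proof. exact: nth_map. Qed.

Lemma nth_adj_mx G t i : i < size t ->
  nth [::] (adj_mx G t) i = adj_row G t (nth x0 t i).
Proof. exact: nth_map. Qed.

Lemma entry_adj_mx G t i j : i < size t -> j < size t ->
  entry (adj_mx G t) i j = adj G (nth x0 t i) (nth x0 t j).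
Proof. by move=> lt_i lt_j; rewrite /entry nth_adj_mx // nth_adj_row. Qed.

(** Complementing at a vertex of [t] changes the edges inside [t] by a rule that involves [t] alone,
    so it commutes with restriction to [t]. *)
Lemma adj_mx_lc G t u : uniq t -> u < size t ->
  adj_mx (local_compl G (nth x0 t u)) t = lc_mx (adj_mx G t) u.
Proof.
move=> Ut lt_u; apply: (@eq_from_nth _ [::]).
  by rewrite size_mkseq !size_map.
move=> i; rewrite size_adj_mx => lt_i.
rewrite nth_adj_mx // /lc_mx nth_mkseq ?size_adj_mx // !nth_adj_mx //.
rewrite [nth false _ i]nth_adj_row //.
apply: (@eq_from_nth _ false) => [|j].
  by case: ifP => _; rewrite ?size_mkseq ?size_map.
rewrite size_map => lt_j; rewrite nth_adj_row // local_complE.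
case: ifP => _; last by rewrite nth_adj_row // addbF.
by rewrite nth_mkseq // !nth_adj_row // nth_uniq.
Qed.

Lemma adj_mx_word G t w : uniq t -> in_range (size t) w ->
  adj_mx (lc_word G (map (nth x0 t) w)) t = foldl lc_mx (adj_mx G t) w.
Proof.
move=> Ut; elim: w G => //= u w IHw G /andP[lt_u lt_w].
by rewrite -adj_mx_lc // -IHw.
Qed.

Lemma adj_mx_sub G t p : in_range (size t) p ->
  adj_mx G (map (nth x0 t) p) = sub_mx (adj_mx G t) p.
Proof.
move/allP=> lt_p; rewrite /adj_mx /adj_row -map_comp.
apply/eq_in_map=> i /lt_p lt_i /=; rewrite -map_comp.
by apply/eq_in_map=> j /lt_p lt_j; rewrite entry_adj_mx.
Qed.

Lemma uniq_map_nth t p : uniq t -> in_range (size t) p -> uniq p ->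
  uniq (map (nth x0 t) p).
Proof.
move=> Ut /allP lt_p Up; rewrite map_inj_in_uniq // => i j /lt_p lt_i /lt_p lt_j.
by move/eqP; rewrite nth_uniq // => /eqP.
Qed.

Lemma sub_map_nth t p : in_range (size t) p -> {subset map (nth x0 t) p <= t}.
Proof. by move/allP=> lt_p _ /mapP[i /lt_p lt_i ->]; apply: mem_nth. Qed.

Lemma lc_iso_mxP G t M w p : uniq t -> lc_iso_mx (adj_mx G t) M w p ->
  exists t', [/\ uniq t', {subset t' <= t}
    & adj_mx (lc_word G (map (nth x0 t) w)) t' = M].
Proof.
move=> Ut; rewrite /lc_iso_mx size_adj_mx => /and4P[lt_w lt_p Up /eqP <-].
exists (map (nth x0 t) p); split.
- exact: uniq_map_nth.
- exact: sub_map_nth.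
- by rewrite adj_mx_sub // adj_mx_word.
Qed.

(** * Adding one vertex *)

(** As [v] lies outside [t], it is never a pivot and differs from every [y] in [t]; each step is
    therefore the linear map of [lc_row]. *)
Lemma adj_row_word G t v w : uniq t -> v \notin t -> in_range (size t) w ->
  adj_row (lc_word G (map (nth x0 t) w)) t v =
  foldl lc_row (adj_row G t v) (pivot_rows (adj_mx G t) w).
Proof.
move=> Ut t'v; elim: w G => //= u w IHw G /andP[lt_u lt_w].
rewrite IHw // adj_mx_lc // nth_adj_mx //; congr (foldl _ _ _).
rewrite /lc_row /= nth_adj_row // zip_map -map_comp.
have step y : y \in t -> adj (local_compl G (nth x0 t u)) v y =
    adj G v y (+) (adj G v (nth x0 t u) && adj G (nth x0 t u) y).
  move=> ty; rewrite local_complE (adj_sym G _ v).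
  by rewrite (_ : v != y) ?andbT //; apply: contraNneq t'v => ->.
case: ifP => Guv; apply/eq_in_map=> y ty; rewrite step // Guv //=.
by rewrite addbF.
Qed.

Lemma adj_mx_cons G t v :
  adj_mx G (v :: t) = extend_mx (adj_mx G t) (adj_row G t v).
Proof.
rewrite /adj_mx /extend_mx /= adj_irrefl zip_map -map_comp.
by congr (_ :: _); apply: eq_map => x /=; rewrite adj_sym.
Qed.

Lemma indep_mxP G t (S : seq nat) : in_range (size t) S ->
  indep_mx (adj_mx G t) S ->
  {in map (nth x0 t) S &, forall x y, adj G x y = false}.
Proof.
move=> /allP lt_S /allP indS _ _ /mapP[i Si ->] /mapP[j Sj ->].
by move/allP/(_ _ Sj): (indS _ Si); rewrite entry_adj_mx ?lt_S // => /negbTE.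
Qed.

Lemma size_triples n S : S \in triples n -> size S = 3.
Proof.
case/flattenP=> _ /mapP[k _ ->] /flattenP[_ /mapP[j _ ->]].
by case/mapP=> i _ ->.
Qed.

Lemma unsettledP G t v w Ns : uniq t -> v \notin t -> in_range (size t) w ->
  adj_row G t v \in Ns ->
  adj_row G t v \in unsettled (adj_mx G t) w Ns \/ lc_indep 4 G.
Proof.
move=> Ut t'v lt_w Ns_v; rewrite mem_filter Ns_v andbT.
case: hasP => [[S SS avS]|]; [right; move: SS avS | by left].
rewrite mem_filter -adj_row_word // -adj_mx_word // size_adj_mx.
case/andP=> /and3P[lt_S US indS] /size_triples szS /allP avS.
set G' := lc_word G _ in indS avS.
exists (map (nth x0 t) w), (v :: map (nth x0 t) S); split.
- rewrite /= uniq_map_nth // andbT.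
  by apply: contra t'v; apply: sub_map_nth.
- by rewrite /= size_map szS.
have vS y : y \in map (nth x0 t) S -> adj G' v y = false.
  case/mapP=> i Si ->; move/allP/(_ _ Si): lt_S => lt_i.
  by move/(_ _ Si): avS; rewrite nth_adj_row // => /negbTE.
move=> x y; rewrite !inE => /predU1P[->|Sx] /predU1P[->|Sy].
- exact: adj_irrefl.
- exact: vS.
- by rewrite adj_sym; apply: vS.
- exact: (indep_mxP lt_S indS).
Qed.

Lemma mem_all_rows N : N \in all_rows (size N).
Proof.
elim: N => //= b N IHN; rewrite mem_cat.
by apply/orP; case: b; [right | left]; apply: map_f.
Qed.

Lemma extensions_okP G t v Ms c : uniq (v :: t) ->
  extensions_ok Ms (adj_mx G t) c ->
  lc_indep 4 G \/ exists s t', [/\ uniq t', {subset t' <= v :: t}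
    & adj_mx (lc_word G s) t' \in Ms].
Proof.
move=> Uvt; have /andP[t'v Ut] := Uvt; case: c => ws cs.
rewrite /extensions_ok size_adj_mx /= => /andP[ws_ok].
have: adj_row G t v \in all_rows (size t).
  by rewrite -(size_map (adj G v)); apply: mem_all_rows.
(* With the list of rows generalized, the induction on words carries only the fact that the row of
   [v] is still listed. *)
move: (all_rows _) => Ns; elim: ws Ns ws_ok => [|w ws IHws] Ns /=.
  move=> _; elim: Ns cs => // N Ns IHNs [|[[r w] p] cs] //=.
  rewrite inE => /predU1P[<-|Ns_v] /andP[/andP[lt_r iso] cs_ok]; last exact: IHNs cs_ok.
  right; move: iso; rewrite -adj_mx_cons => /(lc_iso_mxP Uvt)[t' [Ut' st' def]].
  by exists (map (nth x0 (v :: t)) w), t'; rewrite def mem_nth.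
case/andP=> lt_w ws_ok Ns_v.
by case: (unsettledP Ut t'v lt_w Ns_v) => [|indG _]; [apply: IHws | left].
Qed.

(** Induction on [t]. The word obtained for the tail may also change the neighbourhood of [v], but
    every neighbourhood in the listed vertices is covered by the certificate. *)
Lemma classification G t : uniq t -> size t <= 11 -> lc_indep 4 G \/
  exists s t', [/\ uniq t', {subset t' <= t}
    & adj_mx (lc_word G s) t' \in nth [::] classes (size t)].
Proof.
elim: t => [|v t IHt] in G * => [_ _ | /= /andP[t'v Ut] le_t].
  by right; exists [::], [::].
case: (IHt G Ut (ltnW le_t)) => [|[s [t1 [Ut1 st1 Mt1]]]]; first by left.
have /allP/(_ (size t)) := classes_ok; rewrite mem_iota => /(_ le_t).
rewrite all2E => /andP[/eqP eq_sz /allP ok].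
(* The position of the matrix in its level selects its certificate. *)
set M := adj_mx _ _ in Mt1; set i := index M (nth [::] classes (size t)).
have lt_i : i < size (nth [::] classes (size t)) by rewrite index_mem.
have := ok (nth ([::], ([::], [::]))
  (zip (nth [::] classes (size t)) (nth [::] certificates (size t))) i).
rewrite mem_nth ?size_zip -?eq_sz ?minnn // nth_zip //= nth_index // => /(_ isT) /=.
have Uvt1 : uniq (v :: t1) by rewrite /= Ut1 andbT; apply: contra t'v; apply: st1.
case/(extensions_okP Uvt1) => [/lc_indep_word|[s' [t2 [Ut2 st2 Mt2]]]]; first by left.
right; exists (s ++ s'), t2; rewrite lc_word_cat; split=> // x /st2.
by rewrite !inE => /orP[->|/st1->]; rewrite ?orbT.
Qed.

End Realization.

(** * Edgeless vertex-minors and passage to larger graphs *)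

(** An isomorphism from E_k onto an induced subgraph amounts to an enumeration of [k] distinct,
    pairwise nonadjacent vertices. *)
Lemma vertex_minor_edgelessP (T : finType) k (G : sgraph T) :
  vertex_minor (edgeless k) G <-> lc_indep k G.
Proof.
split=> [[G' [s eqG'] [S [f bij_f adj_f]]] | [s [t [Ut szt indt]]]].
  exists s, [seq val (f i) | i <- enum 'I_k]; split.
  - rewrite map_inj_uniq ?enum_uniq // => i j /val_inj.
    exact: (bij_inj bij_f).
  - by rewrite size_map size_enum_ord.
  - by move=> _ _ /mapP[i _ ->] /mapP[j _ ->]; rewrite -eqG'; apply: adj_f.
exists (lc_word G s); first by exists s.
have St (i : 'I_k) : tnth (Tuple (introT eqP szt)) i \in [set x in t].
  by rewrite inE; apply: (mem_tnth i (Tuple _)).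
pose f i : {x : T | x \in [set x in t]} := exist (fun x => x \in [set x in t]) _ (St i).
exists [set x in t], f; last first.
  by move=> i j; apply: indt; rewrite -[_ \in t]in_set; apply: St.
apply: inj_card_bij => [i j /(congr1 val) /= eq_ij|].
  apply: val_inj; move/eqP: eq_ij.
  by rewrite !(tnth_nth (val (f i))) /= nth_uniq ?szt // => /eqP.
by rewrite card_sig card_ord cardsE (card_uniqP Ut) szt.
Qed.

Lemma lc_word_embed (T U : finType) (f : T -> U) (G : sgraph T) (H : sgraph U) s :
  injective f -> (forall x y, adj H (f x) (f y) = adj G x y) ->
  forall x y, adj (lc_word H (map f s)) (f x) (f y) = adj (lc_word G s) x y.
Proof.
move=> inj_f; elim: s G H => //= v s IHs G H eqHG; apply: IHs => x y.
by rewrite !local_complE !eqHG (inj_eq inj_f).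
Qed.

(** Complementing at images under [f] acts on the induced copy of [G] as in [G]; this carries the
    lower bound from 10 vertices down to fewer. *)
Lemma lc_indep_embed (T U : finType) (f : T -> U) k (G : sgraph T) (H : sgraph U) :
  injective f -> (forall x y, adj H (f x) (f y) = adj G x y) ->
  lc_indep k G -> lc_indep k H.
Proof.
move=> inj_f eqHG [s [t [Ut szt indt]]].
exists (map f s), (map f t); rewrite map_inj_uniq // size_map; split=> //.
move=> _ _ /mapP[x tx ->] /mapP[y ty ->].
by rewrite (lc_word_embed s inj_f eqHG); apply: indt.
Qed.

(** * A graph on ten vertices without E_4 *)

Definition graph10_mx : matrix := nth [::] orbit10 0.

Definition graph10_adj : rel 'I_10 := fun i j => entry graph10_mx i j.

Lemma graph10_sym : symmetric graph10_adj.
Proof.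
have /allP sym : all (fun i => all (fun j =>
    entry graph10_mx i j == entry graph10_mx j i) (iota 0 10)) (iota 0 10).
  by vm_compute.
have lt10 (i : 'I_10) : (i : nat) \in iota 0 10 by rewrite mem_iota ltn_ord.
by move=> i j; have /allP/(_ _ (lt10 j))/eqP := sym _ (lt10 i).
Qed.

Lemma graph10_irrefl : irreflexive graph10_adj.
Proof.
have /allP irr : all (fun i => ~~ entry graph10_mx i i) (iota 0 10) by vm_compute.
by move=> i; apply/negbTE/irr; rewrite mem_iota ltn_ord.
Qed.

Definition graph10 : sgraph 'I_10 := SGraph graph10_sym graph10_irrefl.

Lemma adj_mx_graph10 : adj_mx graph10 (enum 'I_10) = graph10_mx.
Proof.
have eqM : sub_mx graph10_mx (iota 0 10) = graph10_mx by vm_compute.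
rewrite -[RHS]eqM -val_enum_ord /sub_mx -map_comp; apply: eq_map => i /=.
by rewrite -map_comp.
Qed.

(** All matrices of [orbit10] have size 10, so [t] exhausts the vertices. *)
Lemma orbit10_full (G : sgraph 'I_10) t v :
  uniq t -> adj_mx G t \in orbit10 -> v \in t.
Proof.
move=> /card_uniqP card_t Mt.
have /allP/(_ _ Mt) : all (fun M => size M == 10) orbit10 by vm_compute.
rewrite size_adj_mx -card_t -[X in _ == X](card_ord 10) => /eqP/subset_cardP eqT.
by rewrite (eqT _) //; apply/subsetP.
Qed.

(** Since [t] contains every vertex, [v] is one of the checked pivots; the certified isomorphism
    gives the new order [t']. *)
Lemma orbit10_lc (G : sgraph 'I_10) t v : uniq t -> adj_mx G t \in orbit10 ->
  exists2 t', uniq t' & adj_mx (local_compl G v) t' \in orbit10.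
Proof.
move=> Ut Mt.
have tv := orbit10_full v Ut Mt.
have := orbit10_closed; rewrite /orbit_closed all2E => /andP[/eqP eq_sz /allP ok].
set M := adj_mx G t in Mt; pose i := index M orbit10.
have lt_i : i < size orbit10 by rewrite index_mem.
have := ok (nth ([::], [::]) (zip orbit10 orbit10_certificates) i).
rewrite mem_nth ?size_zip -?eq_sz ?minnn // nth_zip // nth_index // => /(_ isT).
move: (nth _ _ i) => rps /=; rewrite all2E => /andP[/eqP szr /allP {}ok].
have lt_u : index v t < size M by rewrite size_adj_mx index_mem.
have := ok (nth (0, (0, [::])) (zip (iota 0 (size M)) rps) (index v t)).
rewrite mem_nth ?size_zip -?szr ?size_iota ?minnn // nth_zip // nth_iota // add0n.
case/(_ isT)/andP=> lt_r /(lc_iso_mxP v Ut)[t' [Ut' _]] /=.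
by rewrite nth_index // => def; exists t' => //; rewrite def mem_nth.
Qed.

Lemma orbit10_word (G : sgraph 'I_10) t s : uniq t -> adj_mx G t \in orbit10 ->
  exists2 t', uniq t' & adj_mx (lc_word G s) t' \in orbit10.
Proof.
elim: s G t => [|v s IHs] G t Ut Mt; first by exists t.
by have [t' Ut' Mt'] := orbit10_lc v Ut Mt; apply: IHs Mt'.
Qed.

Lemma no_indep4P (T : finType) (G : sgraph T) t t4 : no_indep4 (adj_mx G t) ->
  uniq t4 -> size t4 = 4 -> {subset t4 <= t} ->
  ~ {in t4 &, forall x y, adj G x y = false}.
Proof.
move=> no4; case: t4 => [|a [|b [|c [|d []]]]] //=.
rewrite !inE !negb_or !andbT => /and3P[/and3P[ab ac ad] /andP[bc bd] cd] _ st ind.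
have [ta tb tc td] : [/\ a \in t, b \in t, c \in t & d \in t].
  by split; apply: st; rewrite !inE eqxx ?orbT.
have idx x : x \in t -> index x t \in iota 0 (size (adj_mx G t)).
  by rewrite mem_iota size_adj_mx index_mem.
have ne x y : x \in t -> y \in t -> x != y -> eqn (index x t) (index y t) = false.
  move=> tx ty; apply: contraNF => /eqnP eq_xy.
  by rewrite -(nth_index a tx) eq_xy nth_index.
have non x y : x \in t -> y \in t -> x \in [:: a; b; c; d] ->
    y \in [:: a; b; c; d] -> entry (adj_mx G t) (index x t) (index y t) = false.
  move=> tx ty x4 y4; rewrite (entry_adj_mx a) ?index_mem // !nth_index //.
  exact: ind.
move/allP/(_ _ (idx a ta))/allP/(_ _ (idx b tb)): no4.
rewrite ne ?non ?inE ?eqxx ?orbT //= => /allP/(_ _ (idx c tc)).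
rewrite !ne ?non ?inE ?eqxx ?orbT //= => /allP/(_ _ (idx d td)).
by rewrite !ne ?non ?inE ?eqxx ?orbT.
Qed.

Lemma graph10_no_indep4 : ~ lc_indep 4 graph10.
Proof.
case=> s [t4 [Ut4 szt4 ind]].
have [|t Ut Mt] := @orbit10_word graph10 (enum 'I_10) s (enum_uniq _).
  by rewrite adj_mx_graph10 mem_nth.
have /allP/(_ _ Mt) no4 := orbit10_no_indep4.
by apply: (no_indep4P no4 Ut4 szt4 _ ind) => x _; apply: orbit10_full Mt.
Qed.

(** * Upper and lower bound combined *)

Theorem theorem4p3 : vm_ramsey 4 11.
Proof.
split=> [T G szT | m unav].
  apply: (proj2 (vertex_minor_edgelessP 4 G)).
  have x0 : T by case: (pickP T) => // T0; move: szT; rewrite eq_card0.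
  have le11 : size (enum T) <= 11 by rewrite -cardE szT.
  (* On 11 vertices the second alternative asks for a member of the empty level 11. *)
  case: (classification x0 G (enum_uniq T) le11) => // -[s [t [_ _]]].
  by rewrite -cardE szT.
(* For [m] at most 10, the first [m] vertices of [graph10] induce a graph whose E_4 would be one of
   [graph10]. *)
rewrite leqNgt; apply/negP=> lt_m; apply: graph10_no_indep4.
pose f := widen_ord (lt_m : m <= 10).
pose G := @SGraph 'I_m (fun i j => adj graph10 (f i) (f j))
  (fun i j => adj_sym graph10 (f i) (f j)) (fun i => adj_irrefl graph10 (f i)).
apply: (@lc_indep_embed _ _ f 4 G) => //.
  by move=> i j /(congr1 val) /= /val_inj.
by apply: (proj1 (vertex_minor_edgelessP 4 G)); apply: unav; rewrite card_ord.
Qed.
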